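(* Let $G=(V,E)$ be a finite undirected graph with $|V|=n$, node labels $\ell:V\to\mathbb{R}^{d_0}$ and Laplacian $L=U\Lambda U^\top$ ($U$ orthogonal, $\Lambda$ diagonal), and let $\mathcal{L}\in\mathbb{R}^{n^2\times d}$ be the matrix of initial pair labels, whose row indexed by $(u,v)\in V\times V$ is $\ell^{(0)}(u,v)=\bigl(\ell(u),\ell(v),\mathbf 1_{u=v},\mathbf 1_{(u,v)\in E}\bigr)$ (so $d=2d_0+2$). Let $\chi^{(\infty)}_{(u,v)}$ denote the stable Local 2-GNN color of $(u,v)$. Suppose that $L$ has a simple spectrum (its $n$ eigenvalues are pairwise distinct) and that $U^\top\mathcal{L}U$ is index-wise nonzero, i.e. for every $(i,j)\in\{1,\dots,n\}^2$ there is a channel $c$ with $(U^\top\mathcal{L}^{(c)}U)_{ij}\ne 0$, where $\mathcal{L}^{(c)}\in\mathbb{R}^{n\times n}$ is the $c$-th column of $\mathcal{L}$ viewed as a matrix indexed by $V\times V$. Then there exist a real bivariate polynomial $q$ and a real matrix $W$ with $d$ rows such that $\mathcal{L}'=q(L\otimes I_n,\,I_n\otimes L)\,\mathcal{L}\,W$ satisfies, for all $(u_1,v_1),(u_2,v_2)\in V\times V$, $$\mathcal{L}'(u_1,v_1)=\mathcal{L}'(u_2,v_2)\ \Longrightarrow\ \chi^{(\infty)}_{(u_1,v_1)}=\chi^{(\infty)}_{(u_2,v_2)},$$ where $\mathcal{L}'(u,v)$ is the row of $\mathcal{L}'$ indexed by $(u,v)$.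
   Context: The Laplacian $L$ is either $D-A$ or $I-D^{-1/2}AD^{-1/2}$, with $A$ the adjacency matrix and $D$ the degree matrix. For $q(s,t)=\sum_{a,b}\alpha_{ab}s^at^b$, the operator $q(L\otimes I_n,I_n\otimes L):=\sum_{a,b}\alpha_{ab}(L\otimes I_n)^a(I_n\otimes L)^b$ acts on each column of an $n^2\times d$ matrix, a column being viewed as a function $\varepsilon$ on $V\times V$ (an $n\times n$ matrix, identified with a vector by column-stacking): $((L\otimes I_n)\varepsilon)(u,v)=\sum_{v'}\varepsilon(u,v')L_{v'v}$ and $((I_n\otimes L)\varepsilon)(u,v)=\sum_{u'}L_{uu'}\varepsilon(u',v)$. Local 2-GNN refinement: colors of ordered pairs $(u,v)\in V\times V$ are initialized by $\chi^{(0)}_{(u,v)}=\ell^{(0)}(u,v)$, and for $t\ge 0$ $$\chi^{(t+1)}_{(u,v)}=\mathrm{HASH}\Bigl(\chi^{(t)}_{(u,v)},\ \{\!\!\{\chi^{(t)}_{(w,v)}:w\in N(u)\}\!\!\},\ \{\!\!\{\chi^{(t)}_{(u,w)}:w\in N(v)\}\!\!\}\Bigr),$$ where $N(\cdot)$ denotes the neighborhood in $G$, $\{\!\!\{\cdot\}\!\!\}$ a multiset, and HASH is a perfect (injective) hash function. The process iterates until the induced partition of $V\times V$ stabilizes; $\chi^{(\infty)}$ is the resulting stable coloring. *)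

(* Defs.v *)
From mathcomp Require Import all_boot all_order all_algebra.
From mathcomp Require Import reals finmap multiset mxtens.

Set Implicit Arguments.
Unset Strict Implicit.
Unset Printing Implicit Defensive.

Import Order.TTheory GRing.Theory Num.Theory.
Local Open Scope mset_scope.
Local Open Scope ring_scope.

Section Laplacians.
Variables (R : realType) (n : nat) (e : rel 'I_n).

Definition neighborhood (u : 'I_n) : {set 'I_n} := [set w | e u w].

Definition degree (u : 'I_n) : nat := #|neighborhood u|.

Definition adjacency_mx : 'M[R]_n := \matrix_(i, j) (e i j)%:R.

Definition degree_mx : 'M[R]_n := diag_mx (\row_i (degree i)%:R).

(* Since 0^-1 = 0 in MathComp, the entry of an isolated vertex is 0. *)
Definition degree_inv_sqrt_mx : 'M[R]_n :=
  diag_mx (\row_i (Num.sqrt (degree i)%:R)^-1).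

Definition laplacian_mx : 'M[R]_n := degree_mx - adjacency_mx.

Definition normalized_laplacian_mx : 'M[R]_n :=
  1%:M - degree_inv_sqrt_mx *m adjacency_mx *m degree_inv_sqrt_mx.

End Laplacians.

(* The n eigenvalues are counted with algebraic multiplicity, as the roots of
   the characteristic polynomial. *)
Definition simple_spectrum (R : realType) (n : nat) (L : 'M[R]_n) : Prop :=
  exists2 s : n.-tuple R,
    char_poly L = \prod_(a <- s) ('X - a%:P) & uniq s.

Section PairLabels.
Variables (R : realType) (n d0 : nat) (e : rel 'I_n) (l : 'I_n -> 'rV[R]_d0).

Definition pair_dim (k : nat) : nat := ((k + k) + (1 + 1))%N.

Definition pair_label (u v : 'I_n) : 'rV[R]_(pair_dim d0) :=
  row_mx (row_mx (l u) (l v)) (row_mx (u == v)%:R%:M (e u v)%:R%:M).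

(* Column stacking: the pair (u, v) sits at position v * n + u. *)
Definition pair_index (u v : 'I_n) : 'I_(n * n) := mxtens_index (v, u).

Definition pair_label_mx : 'M[R]_(n * n, pair_dim d0) :=
  \matrix_k (let vu := mxtens_unindex k in pair_label vu.2 vu.1).

End PairLabels.

Definition channel_mx (R : realType) (n d : nat) (M : 'M[R]_(n * n, d))
    (c : 'I_d) : 'M[R]_n :=
  \matrix_(u, v) M (pair_index u v) c.

(* A bivariate polynomial q(s, t) is represented as in polyXY: s is the outer
   variable and t the inner one, so the coefficient of s^a t^b is q`_a`_b. *)
Definition bipoly_mx (R : realType) (m : nat) (q : {poly {poly R}})
    (S T : 'M[R]_m) : 'M[R]_m :=
  \sum_(a < size q) \sum_(b < size q`_a) q`_a`_b *: (S ^+ a *m T ^+ b).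

Definition spectral_filter_mx (R : realType) (n : nat) (q : {poly {poly R}})
    (L : 'M[R]_n) : 'M[R]_(n * n) :=
  bipoly_mx q (L *t 1%:M) (1%:M *t L).

Lemma pair_label_mxE (R : realType) (n d0 : nat) (e : rel 'I_n)
    (l : 'I_n -> 'rV[R]_d0) (u v : 'I_n) :
  row (pair_index u v) (pair_label_mx e l) = pair_label e l u v.
Proof. by apply/rowP=> c; rewrite !mxE mxtens_indexK. Qed.

Lemma sum_mxtens (R : realType) (m n : nat) (F : 'I_(m * n) -> R) :
  \sum_k F k = \sum_i \sum_j F (mxtens_index (i, j)).
Proof.
rewrite pair_bigA (reindex (@mxtens_index m n)) /=; last first.
  by exists (@mxtens_unindex m n) => k _;
    [exact: mxtens_indexK | exact: mxtens_unindexK].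
by apply: eq_bigr => -[].
Qed.

(* For the symmetric matrices L considered here L^T = L. *)
Lemma channel_mx_tensl (R : realType) (n d : nat) (L : 'M[R]_n)
    (M : 'M[R]_(n * n, d)) (c : 'I_d) :
  channel_mx ((L *t 1%:M) *m M) c = channel_mx M c *m L^T.
Proof.
apply/matrixP=> u v; rewrite !mxE sum_mxtens.
apply: eq_bigr => v' _; rewrite !mxE (bigD1 u) //= tensmxE !mxE eqxx mulr1.
rewrite mulrC big1 ?addr0 // => u' neq.
by rewrite tensmxE !mxE eq_sym (negPf neq) mulr0 mul0r.
Qed.

Lemma channel_mx_tensr (R : realType) (n d : nat) (L : 'M[R]_n)
    (M : 'M[R]_(n * n, d)) (c : 'I_d) :
  channel_mx ((1%:M *t L) *m M) c = L *m channel_mx M c.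
Proof.
apply/matrixP=> u v; rewrite !mxE sum_mxtens.
rewrite (bigD1 v) //= [X in _ + X]big1 ?addr0 => [|v' neq]; last first.
  by apply: big1 => u' _; rewrite tensmxE !mxE eq_sym (negPf neq) !mul0r.
by apply: eq_bigr => u' _; rewrite tensmxE !mxE eqxx mul1r.
Qed.

Section Local2GNN.
Variables (n : nat) (e : rel 'I_n) (C : choiceType).
Variables (hash : C * {mset C} * {mset C} -> C) (chi0 : 'I_n * 'I_n -> C).

Fixpoint gnn2_color (t : nat) : 'I_n * 'I_n -> C :=
  if t is t'.+1 then
    fun p => hash (gnn2_color t' p,
      seq_mset [seq gnn2_color t' (w, p.2) | w in neighborhood e p.1],
      seq_mset [seq gnn2_color t' (p.1, w) | w in neighborhood e p.2])
  else chi0.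

Definition gnn2_partition (t : nat) : {set {set 'I_n * 'I_n}} :=
  preim_partition (gnn2_color t) [set: 'I_n * 'I_n].

Definition gnn2_stable_at (t : nat) : bool :=
  gnn2_partition t.+1 == gnn2_partition t.

Hypothesis hash_inj : injective hash.

Lemma gnn2_stabilizes : exists t, gnn2_stable_at t.
Proof.
pose E t := [set x | gnn2_color t x.1 == gnn2_color t x.2].
have stable t : E t.+1 = E t -> gnn2_stable_at t.
  move=> eqE; apply/eqP/eq_imset => x; apply/setP=> y; rewrite !inE /=.
  by move/setP/(_ (x, y)): eqE; rewrite !inE.
have subE t : E t.+1 \subset E t.
  by apply/subsetP=> x; rewrite !inE => /eqP eqx; apply/eqP; case: (hash_inj eqx).
have lt_or_stable t : (exists s, gnn2_stable_at s) \/ (#|E t| + t <= #|E 0%N|)%N.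
  elim: t => [|t [st|IH]]; [by right; rewrite addn0 | by left |].
  have [eqE|neqE] := eqVneq (E t.+1) (E t); first by left; exists t; apply: stable.
  right; rewrite addnS (leq_trans _ IH) // ltn_add2r proper_card //.
  by rewrite properEneq neqE subE.
have [//|] := lt_or_stable #|E 0%N|.+1.
by rewrite addnS leqNgt ltnS leq_addl.
Qed.

Definition gnn2_stable_color : 'I_n * 'I_n -> C :=
  gnn2_color (ex_minn gnn2_stabilizes).

End Local2GNN.

(* Main.v *)
(* A filter of a symmetric matrix with distinct eigenvalues reaches every
   function on pairs, so the color refinement never has to be simulated. Write
   L = U diag(lam) U^T. In the eigenbasis, q(L *t 1, 1 *t L) multiplies the
   (i, j) entry of U^T M U by q(lam_j, lam_i). A generic linear combination M of
   the label channels has all entries of U^T M U nonzero, and since the lam_i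
   are distinct the factors q(lam_j, lam_i) can be interpolated freely; hence M
   can be filtered to any n x n matrix, in particular one with pairwise distinct
   entries, which separates all pairs of vertices. *)
Require Import Defs.
From mathcomp Require Import all_boot all_order all_algebra.
From mathcomp Require Import reals finmap multiset mxtens.

Import Order.TTheory GRing.Theory Num.Theory.
Local Open Scope mset_scope.
Local Open Scope ring_scope.

(** In characteristic zero the first [size p] naturals are distinct, and they are too many to all be
    roots of [p]. *)
Lemma exists_nonroot (F : numDomainType) (p : {poly F}) :
  p != 0 -> exists x, ~~ root p x.
Proof.
move=> p_neq0; pose s : seq F := [seq i%:R | i <- iota 0 (size p)].
have /allPn[x _ rootNx] : ~~ all (root p) s; last by exists x.
apply/negP => /(max_poly_roots p_neq0).
rewrite map_inj_uniq ?iota_uniq; last exact: mulrIn (oner_neq0 F).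
by rewrite size_map size_iota ltnn => /(_ isT).
Qed.

(* The weights are the powers of a point avoiding the roots of all the nonzero
   polynomials [sum_c A k c X^c]. *)
Lemma generic_combination (F : numDomainType) (K : finType) (d : nat)
    (A : K -> 'I_d -> F) :
  (forall k, exists c, A k c != 0) ->
  exists w : 'I_d -> F, forall k, \sum_c A k c * w c != 0.
Proof.
(* The default [0] is never reached, since only indices [i < d] occur. *)
move=> A_neq0; pose p k : {poly F} := \poly_(i < d) oapp (A k) 0 (insub i).
have p_coef k (c : 'I_d) : (p k)`_c = A k c by rewrite coef_poly ltn_ord valK.
have [|x] := @exists_nonroot F (\prod_k p k).
  apply/prodf_neq0 => k _; have [c] := A_neq0 k; apply: contraNneq => p0.
  by rewrite -p_coef p0 coef0.
rewrite rootE horner_prod => /prodf_neq0 nz.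
exists (fun c => x ^+ c) => k; have := nz k isT.
rewrite horner_poly; under eq_bigr => c _ do rewrite valK /=.
exact.
Qed.

Lemma lagrange_basis (F : fieldType) (I : finType) (x : I -> F) :
  injective x ->
  exists b : I -> {poly F}, forall i j, (b i).[x j] = (i == j)%:R.
Proof.
move=> x_inj; pose p i : {poly F} := \prod_(k | k != i) ('X - (x k)%:P).
exists (fun i => ((p i).[x i])^-1 *: p i) => i j; rewrite hornerZ.
have [<-|neq_ij] := eqVneq.
  rewrite mulVf // horner_prod; apply/prodf_neq0 => k neq_ki.
  by rewrite hornerXsubC subr_eq0 inj_eq // eq_sym.
rewrite [X in _ * X]horner_prod (bigD1 j) 1?eq_sym //=.
by rewrite hornerXsubC subrr mul0r mulr0.
Qed.

(** Products of two univariate Lagrange bases interpolate on the grid; [map_poly polyC] puts the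
    first factor in the outer variable. *)
Lemma bivariate_interpolation (F : fieldType) (I J : finType)
    (x : I -> F) (y : J -> F) (c : I -> J -> F) :
  injective x -> injective y ->
  exists q : {poly {poly F}}, forall i j, q.[(x i)%:P].[y j] = c i j.
Proof.
move=> /lagrange_basis[a a_eq] /lagrange_basis[b b_eq].
exists (\sum_i (map_poly polyC (a i) * (\sum_j c i j *: b j)%:P)) => i j.
rewrite horner_sum (bigD1 i) //= hornerD hornerM hornerC horner_map /=.
rewrite a_eq eqxx mul1r !horner_sum (bigD1 j) //= hornerZ b_eq eqxx mulr1.
rewrite [X in _ + X + _]big1 => [|k neq]; last first.
  by rewrite hornerZ b_eq (negPf neq) mulr0.
rewrite big1 ?addr0 // => k neq.
by rewrite hornerM horner_map /= a_eq (negPf neq) mul0r horner0.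
Qed.

(** Conjugation preserves the characteristic polynomial, so unique factorization makes the diagonal
    entries a permutation of the duplicate-free [s]. *)
Lemma simple_spectrum_diag (R : realType) (n : nat) (U : 'M[R]_n)
    (lam : 'rV[R]_n) :
  U^T *m U = 1%:M -> simple_spectrum (U *m diag_mx lam *m U^T) ->
  injective (lam 0).
Proof.
move=> UTU [s s_eq s_uniq].
have UUT : U *m U^T = 1%:M by apply: mulmx1C.
have char_eq : char_poly (U *m diag_mx lam *m U^T) = char_poly (diag_mx lam).
  rewrite /char_poly /char_poly_mx !map_mxM /=.
  have X_eq : 'X%:M = map_mx polyC U *m 'X%:M *m map_mx polyC U^T :> 'M[{poly R}]_n.
    by rewrite mul_mx_scalar -scalemxAl -map_mxM UUT map_mx1 scalemx1.
  rewrite [in LHS]X_eq -mulmxBl -mulmxBr !det_mulmx mulrAC -det_mulmx -map_mxM UUT map_mx1.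
  by rewrite det1 mul1r.
move: char_eq; rewrite s_eq char_poly_trig ?is_diag_mx_is_trig ?diag_mx_is_diag //.
under [RHS]eq_bigr do rewrite mxE eqxx mulr1n.
rewrite -big_enum -(big_map (lam 0) xpredT (fun a => 'X - a%:P)).
move/prod_XsubC_eq/perm_uniq; rewrite s_uniq => lam_uniq; exact/injectiveP/esym.
Qed.

Lemma bipoly_hornerE (R : comNzRingType) (q : {poly {poly R}}) (x y : R) :
  q.[x%:P].[y] = \sum_(a < size q) \sum_(b < size q`_a) q`_a`_b * (x ^+ a * y ^+ b).
Proof.
rewrite [q.[_]]horner_coef horner_sum; apply: eq_bigr => a _.
rewrite hornerM -rmorphXn hornerC horner_coef mulr_suml.
by apply: eq_bigr => b _; rewrite mulrAC mulrA.
Qed.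

Section SpectralFilter.
Variables (R : realType) (n : nat) (U : 'M[R]_n) (lam : 'rV[R]_n).
Hypothesis U_orthogonal : U^T *m U = 1%:M.

Let L := U *m diag_mx lam *m U^T.

(** Entry [(i, j)] is the coordinate of the channel along the rank-one matrix built from columns [i]
    and [j] of [U]. *)
Definition eigen_coef {d} (M : 'M[R]_(n * n, d)) c : 'M[R]_n :=
  U^T *m channel_mx M c *m U.

Let U_orthogonalr : U *m U^T = 1%:M. Proof. exact: mulmx1C. Qed.

Lemma channel_eigen d (M : 'M[R]_(n * n, d)) c :
  channel_mx M c = U *m eigen_coef M c *m U^T.
Proof.
by rewrite /eigen_coef !mulmxA U_orthogonalr mul1mx -mulmxA U_orthogonalr mulmx1.
Qed.

Lemma eigen_coef_sum d I (r : seq I) (P : pred I) (M : I -> 'M[R]_(n * n, d)) c :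
  eigen_coef (\sum_(k <- r | P k) M k) c = \sum_(k <- r | P k) eigen_coef (M k) c.
Proof.
rewrite /eigen_coef -mulmx_suml -mulmx_sumr; congr (_ *m _ *m _).
apply/matrixP => u v; rewrite !mxE !summxE.
by apply: eq_bigr => k _; rewrite mxE.
Qed.

Lemma eigen_coefZ d (M : 'M[R]_(n * n, d)) a c :
  eigen_coef (a *: M) c = a *: eigen_coef M c.
Proof.
rewrite /eigen_coef scalemxAl scalemxAr; congr (_ *m _ *m _).
by apply/matrixP => u v; rewrite !mxE.
Qed.

Let L_sym : L^T = L.
Proof. by rewrite !trmx_mul tr_diag_mx trmxK mulmxA. Qed.

Lemma eigen_coef_tensl d (M : 'M[R]_(n * n, d)) c i j :
  eigen_coef ((L *t 1%:M) *m M) c i j = lam 0 j * eigen_coef M c i j.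
Proof.
rewrite {1}/eigen_coef channel_mx_tensl L_sym -!mulmxA U_orthogonal mulmx1.
by rewrite !mulmxA -/(eigen_coef M c) mul_mx_diag mxE mulrC.
Qed.

Lemma eigen_coef_tensr d (M : 'M[R]_(n * n, d)) c i j :
  eigen_coef ((1%:M *t L) *m M) c i j = lam 0 i * eigen_coef M c i j.
Proof.
rewrite {1}/eigen_coef channel_mx_tensr !mulmxA U_orthogonal mul1mx -!mulmxA.
by rewrite mul_diag_mx mxE mulmxA.
Qed.

Lemma eigen_coef_filter d (q : {poly {poly R}}) (M : 'M[R]_(n * n, d)) c i j :
  eigen_coef (spectral_filter_mx q L *m M) c i j =
    q.[(lam 0 j)%:P].[lam 0 i] * eigen_coef M c i j.
Proof.
rewrite /spectral_filter_mx /bipoly_mx bipoly_hornerE mulmx_suml.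
rewrite eigen_coef_sum summxE mulr_suml; apply: eq_bigr => a _.
rewrite mulmx_suml eigen_coef_sum summxE mulr_suml; apply: eq_bigr => b _.
rewrite -scalemxAl eigen_coefZ mxE -!mulrA; congr (_ * _); rewrite -mulmxA.
(* The powers of [L *t 1%:M] stand leftmost, so they are peeled off first; the base case then peels
   those of [1%:M *t L]. *)
move: (val a) (val b) => /= a' b'; elim: a' => [|k IHk]; last first.
  by rewrite !exprS -mulmxE -mulmxA eigen_coef_tensl IHk -mulrA.
rewrite !expr0 mul1r mul1mx; elim: b' => [|k IHk].
  by rewrite !expr0 mul1r mul1mx.
by rewrite !exprS -mulmxE -mulmxA eigen_coef_tensr IHk -mulrA.
Qed.

End SpectralFilter.

Arguments eigen_coef {R n} U {d} M c.

(** Mixing channels commutes with the change of basis, so weights can be chosen on the eigenbasis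
    coordinates. *)
Lemma eigen_coef_mul_col (R : realType) (n d : nat) (U : 'M[R]_n)
    (M : 'M[R]_(n * n, d)) (w : 'I_d -> R) i j :
  eigen_coef U (M *m \col_c w c) 0 i j = \sum_c eigen_coef U M c i j * w c.
Proof.
have -> : eigen_coef U (M *m \col_c w c) 0 = \sum_c w c *: eigen_coef U M c.
  rewrite /eigen_coef.
  under eq_bigr do rewrite scalemxAl scalemxAr.
  rewrite -mulmx_suml -mulmx_sumr; congr (_ *m _ *m _).
  apply/matrixP => u v; rewrite !mxE summxE; apply: eq_bigr => c _.
  by rewrite !mxE mulrC.
by rewrite summxE; apply: eq_bigr => c _; rewrite mxE mulrC.
Qed.

Theorem theorem3p8 (R : realType) (n d0 : nat)
    (e : rel 'I_n) (e_sym : symmetric e)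
    (l : 'I_n -> 'rV[R]_d0)
    (L U Lam : 'M[R]_n)
    (L_def : L = laplacian_mx R e \/ L = normalized_laplacian_mx R e)
    (U_orthogonal : U^T *m U = 1%:M)
    (Lam_diagonal : is_diag_mx Lam)
    (L_eigen : L = U *m Lam *m U^T)
    (C : choiceType)
    (color : 'rV[R]_(pair_dim d0) -> C) (color_inj : injective color)
    (hash : C * {mset C} * {mset C} -> C) (hash_inj : injective hash)
    (L_simple : simple_spectrum L)
    (nonzero : forall i j : 'I_n, exists c : 'I_(pair_dim d0),
       (U^T *m channel_mx (pair_label_mx e l) c *m U) i j != 0) :
  let chi := gnn2_stable_color e
    (fun p => color (pair_label e l p.1 p.2)) hash_inj in
  exists (q : {poly {poly R}}) (d' : nat) (W : 'M[R]_(pair_dim d0, d')),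
    let L' := spectral_filter_mx q L *m pair_label_mx e l *m W in
    forall u1 v1 u2 v2 : 'I_n,
      row (pair_index u1 v1) L' = row (pair_index u2 v2) L' ->
      chi (u1, v1) = chi (u2, v2).
Proof.
move=> chi.
have /diag_mxP[lam Lam_eq] := Lam_diagonal; rewrite {}Lam_eq in L_eigen.
have lam_inj : injective (lam 0).
  by apply: (simple_spectrum_diag _ _ U); rewrite -?L_eigen.
have [w w_neq0] := @generic_combination R _ _
  (fun ij c => eigen_coef U (pair_label_mx e l) c ij.1 ij.2)
  (fun ij => nonzero ij.1 ij.2).
pose A := eigen_coef U (pair_label_mx e l *m \col_c w c) 0.
have A_neq0 i j : A i j != 0.
  by rewrite /A eigen_coef_mul_col; apply: (w_neq0 (i, j)).
(* The target has pairwise distinct entries because [pair_index] is injective. *)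
pose X : 'M[R]_n := \matrix_(u, v) (pair_index u v : nat)%:R.
pose Y := U^T *m X *m U.
(* The column index [j] comes first because the outer variable stands for [L *t 1%:M], which scales
   column [j]. *)
have [q q_eq] := @bivariate_interpolation R _ _ (lam 0) (lam 0)
  (fun j i => Y i j / A i j) lam_inj lam_inj.
exists q, 1%N, (\col_c w c) => L' u1 v1 u2 v2.
have UUT : U *m U^T = 1%:M by apply: mulmx1C.
have L'_eq : channel_mx L' 0 = X.
  rewrite (@channel_eigen R n U U_orthogonal).
  have -> : eigen_coef U L' 0 = Y.
    apply/matrixP => i j; rewrite /L' -mulmxA L_eigen eigen_coef_filter //.
    by rewrite q_eq -/A divfK.
  by rewrite /Y !mulmxA UUT mul1mx -mulmxA UUT mulmx1.
move/rowP/(_ 0); rewrite !mxE => L'_row.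
have: X u1 v1 = X u2 v2 by rewrite -L'_eq !mxE.
(* Equal entries of [X] force equal pairs, so the colors agree trivially. *)
rewrite !mxE => /(mulrIn (oner_neq0 R))/val_inj/(can_inj (@mxtens_indexK n n)).
by case=> -> ->.
Qed.
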